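(* Let $F:\overline{\Omega_\eta}\times\overline{\mathcal T_\nu}\to{}^{*}\mathbb{R}_{\geq0}$ be the evolution of the initial function $f$ under the $\frac13,\frac13,\frac13$ nonstandard Markov chain, as defined in the context. Then there exist a reverse filtration on $\overline{\Omega_\eta}$ and an extension of $F$ to $\overline F:\overline{\Omega_\eta}\times\overline{\mathcal T_\nu}\to{}^{*}\mathbb{R}$ (that is, $\overline F$ agrees with $F$ at the points $(\frac i\eta,\frac j\nu)$, $0\leq i\leq\eta-1$, $0\leq j\leq\nu$) such that $\overline F$ is a reverse martingale. Moreover, the processes $F$ and $\overline F$ are equivalent in distribution.
   Context: We work in a nonstandard extension; $a\simeq b$ means $a-b$ is infinitesimal, and $[\cdot]$ is the integer part. Let $\eta,\lambda\in{}^{*}\mathbb{N}\setminus\mathbb{N}$ and let $\nu\in{}^{*}\mathbb{N}$ satisfy $$\nu\geq(\eta-1)\Big(1+\frac{\log(\epsilon)}{\log(3^{\eta-1}-1)-\log(3^{\eta-1})}\Big)$$ where $\epsilon>0$ is an infinitesimal with $\lambda\epsilon\simeq0$. **Spaces.** Let $\overline{\Omega_\eta}=\{x\in{}^{*}\mathbb{R}:0\leq x<1\}$ and $\overline{\mathcal T_\nu}=\{t\in{}^{*}\mathbb{R}:0\leq t\leq1\}$. $\mathcal C_\eta$ consists of internal unions of the intervals $[\frac i\eta,\frac{i+1}\eta)$, $0\leq i\leq\eta-1$; $\mathcal D_\nu$ consists of internal unions of the intervals $[\frac i\nu,\frac{i+1}\nu)$, $0\leq i\leq\nu-1$, and $\{1\}$.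 A function is measurable with respect to such a $*$-algebra if it is internal and preimages of $*$-Borel sets lie in the algebra. **The process $F$.** Let $f:\overline{\Omega_\eta}\to{}^{*}\mathbb{R}_{\geq0}$ be $\mathcal C_\eta$-measurable with ${}^{*}\sum_{0\leq i\leq\eta-1}f(\frac i\eta)=\lambda$. Let $\pi_f$ be the internal row vector $(f(\frac i\eta))_{0\leq i\leq\eta-1}$, and let $K$ be the internal transition matrix of the Markov chain on $\{0,\ldots,\eta-1\}$ which moves from $i$ to each of $i-1,i,i+1$ (mod $\eta$) with probability $\frac13$. Define $F(\frac i\eta,\frac j\nu)=(\pi_fK^j)(i)$ for $0\leq i\leq\eta-1$, $0\leq j\leq\nu$ ($K^j$ the internal power), and $F(x,y)=F(\frac{[x\eta]}\eta,\frac{[y\nu]}\nu)$ for $(x,y)\in\overline{\Omega_\eta}\times\overline{\mathcal T_\nu}$. **Reverse filtrations.** Let $(\overline{\Omega_\eta},\mathcal E_\eta,\gamma_\eta)$ be a nonstandard $*$-finite measure space. A reverse filtration on $\overline{\Omega_\eta}$ is an internal collection of $*\sigma$-algebras $\mathcal E_{\eta,i}$, indexed by $0\leq i\leq\nu$, such that (i) $\mathcal E_{\eta,0}=\mathcal E_\eta$; (ii) $\mathcal E_{\eta,i}\subseteq\mathcal E_{\eta,j}$ if $i\geq j$. (The measure space $(\overline{\Omega_\eta},\mathcal E_\eta,\gamma_\eta)$ is part of the data of the reverse filtration.) For $H:\overline{\Omega_\eta}\times\overline{\mathcal T_\nu}\to{}^{*}\mathbb{R}$ write $H_t(x)=H(x,t)$.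 $H$ is adapted to the reverse filtration if $H$ is measurable with respect to $\mathcal E_\eta\times\mathcal D_\nu$ and $H_{i/\nu}$ is measurable with respect to $\mathcal E_{\eta,i}$ for $0\leq i\leq\nu$. If $h:\overline{\Omega_\eta}\to{}^{*}\mathbb{R}$ is measurable with respect to $\mathcal E_{\eta,j}$ and $0\leq j\leq i\leq\nu$, the conditional expectation $E_\eta(h|\mathcal E_{\eta,i})$ is the unique $\mathcal E_{\eta,i}$-measurable $g:\overline{\Omega_\eta}\to{}^{*}\mathbb{R}$ such that $\int_Ug\,d\gamma_\eta=\int_Uh\,d\gamma_\eta$ for all $U\in\mathcal E_{\eta,i}$. $H$ is a reverse martingale if (i) $H$ is adapted to the reverse filtration, and (ii) $E_\eta(H_{j/\nu}|\mathcal E_{\eta,i})=H_{i/\nu}$ for $0\leq j\leq i\leq\nu$. **Equivalence in distribution.** For $H$ measurable with respect to $\mathcal E_\eta\times\mathcal D_\nu$, its cumulative density function is $P(x,t)=\gamma_\eta(H_t\leq x)$, for $x\in{}^{*}\mathbb{R}$ and $t\in\overline{\mathcal T_\nu}$. $H_1$ and $H_2$ (both measurable with respect to $\mathcal E_\eta\times\mathcal D_\nu$) are equivalent in distribution if their cumulative density functions $P_1$ and $P_2$ coincide. *)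

(* Defs.v *)
From mathcomp Require Import all_boot all_order all_algebra.
From mathcomp Require Import all_classical all_reals all_analysis.

Set Implicit Arguments.
Unset Strict Implicit.
Unset Printing Implicit Defensive.

Import Order.TTheory GRing.Theory Num.Theory.
Import numFieldNormedType.Exports.

Local Open Scope classical_set_scope.
Local Open Scope ring_scope.

(** A nonstandard extension assigns to each type [T] its extension *T, to each
  function its extension, and to each set its extension.  The laws are the
  transfer principle: *(A x B) = *A x *B, and * commutes with composition,
  conjunction, negation, substitution (preimages) and existential
  quantification (images, e.g. along projections).  The internal subsets of *T
  are the elements of *(set T), and the internal functions from *A to *B are
  the elements of *(A -> B). *)
Record nsextension := NSExtension {
  star : Type -> Type;
  smap : forall A B : Type, (A -> B) -> star A -> star B;
  sset : forall A : Type, set A -> set (star A);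
  spoint : star unit;
  spair : forall A B : Type, star A -> star B -> star (A * B);
  smap_id : forall (A : Type) (x : star A), smap id x = x;
  smap_comp : forall (A B C : Type) (g : B -> C) (f : A -> B) (x : star A),
    smap (g \o f) x = smap g (smap f x);
  smap_fst : forall (A B : Type) (x : star A) (y : star B),
    smap fst (spair x y) = x;
  smap_snd : forall (A B : Type) (x : star A) (y : star B),
    smap snd (spair x y) = y;
  spair_eta : forall (A B : Type) (z : star (A * B)),
    spair (smap fst z) (smap snd z) = z;
  ssetI : forall (A : Type) (P Q : set A),
    sset (P `&` Q) = sset P `&` sset Q;
  ssetC : forall (A : Type) (P : set A), sset (~` P) = ~` sset P;
  sset_preimage : forall (A B : Type) (f : A -> B) (Q : set B),
    sset (f @^-1` Q) = smap f @^-1` sset Q;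
  sset_image : forall (A B : Type) (f : A -> B) (P : set A),
    sset (f @` P) = smap f @` sset P
}.

Arguments smap {n A B}.
Arguments sset {n A}.
Arguments spoint {n}.
Arguments spair {n A B}.

Definition std (S : nsextension) (T : Type) (a : T) : star S T :=
  smap (fun=> a) spoint.

Definition ext1 (S : nsextension) (A B : Type) (f : A -> B)
    (x : star S A) : star S B :=
  smap f x.
Definition ext2 (S : nsextension) (A B C : Type) (f : A -> B -> C)
    (x : star S A) (y : star S B) : star S C :=
  smap (fun p => f p.1 p.2) (spair x y).
Definition ext3 (S : nsextension) (A B C D : Type) (f : A -> B -> C -> D)
    (x : star S A) (y : star S B) (z : star S C) : star S D :=
  smap (fun p => f p.1.1 p.1.2 p.2) (spair (spair x y) z).
Definition rel1 (S : nsextension) (A : Type) (P : A -> Prop)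
    (x : star S A) : Prop :=
  sset (fun a => P a) x.
Definition rel2 (S : nsextension) (A B : Type) (P : A -> B -> Prop)
    (x : star S A) (y : star S B) : Prop :=
  sset (fun p => P p.1 p.2) (spair x y).
Definition rel3 (S : nsextension) (A B C : Type) (P : A -> B -> C -> Prop)
    (x : star S A) (y : star S B) (z : star S C) : Prop :=
  sset (fun p => P p.1.1 p.1.2 p.2) (spair (spair x y) z).

Definition app (S : nsextension) (A B : Type) (f : star S (A -> B))
    (x : star S A) : star S B :=
  ext2 (fun f x => f x) f x.

Definition smem (S : nsextension) (T : Type) (x : star S T)
    (A : star S (set T)) : Prop :=
  rel2 (fun x A => A x) x A.

Definition sle (S : nsextension) (d : Order.disp_t) (T : porderType d)
    (x y : star S T) : Prop :=
  rel2 (fun x y => (x <= y)%O) x y.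
Definition slt (S : nsextension) (d : Order.disp_t) (T : porderType d)
    (x y : star S T) : Prop :=
  rel2 (fun x y => (x < y)%O) x y.

Notation "x \in* A" := (smem x A) (at level 70).
Notation "x <=* y" := (sle x y) (at level 70).
Notation "x <* y" := (slt x y) (at level 70).

Definition infinite (S : nsextension) (x : star S nat) : Prop :=
  forall n : nat, x <> std S n.

Definition infinitely_close (S : nsextension) (R : realType)
    (x y : star S R) : Prop :=
  forall n : nat, rel2 (fun a b => `|a - b| < n.+1%:R^-1) x y.

Notation "x ≃ y" := (infinitely_close x y) (at level 70).

Definition snatr (S : nsextension) (R : realType) (n : star S nat) :
    star S R :=
  ext1 (fun k => k%:R) n.

Definition sfrac (S : nsextension) (R : realType) (i n : star S nat) :
    star S R :=
  ext2 (fun k m => k%:R / m%:R) i n.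

(** [Omega] and [Time] are standard sets, whose extensions are the nonstandard
  intervals [0, 1) and [0, 1].  Functions on them are taken to be total, and
  only their values on the extensions of these sets are ever used. *)
Definition Omega (R : realType) : set R := [set x | 0 <= x < 1].
Definition Time (R : realType) : set R := [set t | 0 <= t <= 1].
Arguments Omega : clear implicits.
Arguments Time : clear implicits.

Definition cells (R : realType) (n : nat) : set (set R) :=
  [set [set x : R | i%:R / n%:R <= x < i.+1%:R / n%:R] | i in `I_n].
Arguments cells : clear implicits.

Definition unions_of (T : Type) (C : set (set T)) : set (set T) :=
  [set \bigcup_(A in D) A | D in [set D | D `<=` C]].

Definition Calg (S : nsextension) (R : realType) (eta : star S nat) :
    star S (set (set R)) :=
  ext1 (fun n => unions_of (cells R n)) eta.

Definition Dalg (S : nsextension) (R : realType) (nu : star S nat) :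
    star S (set (set R)) :=
  ext1 (fun n => unions_of (cells R n `|` [set [set 1]])) nu.

Definition prod_alg (S : nsextension) (T T' : Type) (D : set T) (D' : set T')
    (E : star S (set (set T))) (E' : star S (set (set T'))) :
    star S (set (set (T * T'))) :=
  ext2 (fun G G' => <<s D `*` D', [set A `*` B | A in G & B in G'] >>) E E'.

Definition smeasurable (S : nsextension) (R : realType) (T : Type) (D : set T)
    (E : star S (set (set T))) (h : star S (T -> R)) : Prop :=
  forall B : star S (set R), rel1 (fun B => measurable B) B ->
    ext2 (fun h B => D `&` h @^-1` B) h B \in* E.

Definition initial_row (R : realType) (n : nat) (f : R -> R) : 'rV[R]_n :=
  \row_(i < n) f (i%:R / n%:R).

(* For n >= 3 the states i - 1, i, i + 1 are distinct mod n, so the nonzero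
   entries are all equal to 1 / 3. *)
Definition transition (R : realType) (n : nat) : 'M[R]_n :=
  \matrix_(i < n, k < n)
    (((k == ord_pred i) + (k == i) + (k == ordS i))%:R / 3%:R).

Definition row_entry (R : realType) (n : nat) (v : 'rV[R]_n) (i : nat) : R :=
  oapp (fun k : 'I_n => v 0 k) 0 (insub i).

(* The value at [p] is the one at the grid point below [p]. *)
Definition evolution (R : realType) (n m : nat) (f : R -> R) (p : R * R) : R :=
  row_entry (initial_row n f *m transition R n ^+ Num.truncn (p.2 * m%:R))
    (Num.truncn (p.1 * n%:R)).

Definition process (S : nsextension) (R : realType) (eta nu : star S nat)
    (f : star S (R -> R)) : star S (R * R -> R) :=
  ext3 (@evolution R) eta nu f.

Definition sigma_algebra_on (T : Type) (D : set T) (E : set (set T)) : Prop :=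
  sigma_algebra D E /\ forall A, E A -> A `<=` D.

(** Finite measure spaces on [Omega R]; the elements of the extension of this
  type are the *-finite measure spaces.  [fms_alg] lives on [Omega R] while the
  library generates sigma-algebras on the whole type, so that the complement of
  [Omega R] is also measurable; its measure plays no role. *)
Record fin_measure_space (R : realType) := FinMeasureSpace {
  fms_alg : set (set R);
  fms_sigma_algebra : sigma_algebra_on (Omega R) fms_alg;
  fms_finite : finite_set fms_alg;
  fms_measure :
    {finite_measure set (g_sigma_algebraType fms_alg) -> \bar R}
}.

Definition fms_integral (R : realType) (M : fin_measure_space R)
    (U : set R) (h : R -> R) : \bar R :=
  (\int[fms_measure M]_(x in U) (h x)%:E)%E.

Record reverse_filtration (S : nsextension) (R : realType)
    (nu : star S nat) := ReverseFiltration {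
  rf_space : star S (fin_measure_space R);
  rf_algs : star S (nat -> set (set R));
  rf_sigma_algebra : forall i : star S nat, i <=* nu ->
    rel1 (sigma_algebra_on (Omega R)) (app rf_algs i);
  rf_0 : app rf_algs (std S 0%N) = ext1 (@fms_alg R) rf_space;
  rf_decreasing : forall i j : star S nat, i <=* nu -> j <=* i ->
    forall A : star S (set R), A \in* app rf_algs i -> A \in* app rf_algs j
}.

Definition total_alg (S : nsextension) (R : realType) (nu : star S nat)
    (E : reverse_filtration R nu) : star S (set (set R)) :=
  ext1 (@fms_alg R) (rf_space E).

Definition slice (S : nsextension) (R : realType) (H : star S (R * R -> R))
    (t : star S R) : star S (R -> R) :=
  ext2 (fun H t x => H (x, t)) H t.

Definition process_measurable (S : nsextension) (R : realType)
    (nu : star S nat) (E : reverse_filtration R nu)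
    (H : star S (R * R -> R)) : Prop :=
  smeasurable (Omega R `*` Time R)
    (prod_alg (Omega R) (Time R) (total_alg E) (Dalg R nu)) H.

Definition adapted (S : nsextension) (R : realType) (nu : star S nat)
    (E : reverse_filtration R nu) (H : star S (R * R -> R)) : Prop :=
  process_measurable E H /\
  forall i : star S nat, i <=* nu ->
    smeasurable (Omega R) (app (rf_algs E) i) (slice H (sfrac R i nu)).

Definition same_integrals (S : nsextension) (R : realType) (nu : star S nat)
    (E : reverse_filtration R nu) (i : star S nat)
    (g h : star S (R -> R)) : Prop :=
  forall U : star S (set R), U \in* app (rf_algs E) i ->
    ext3 (@fms_integral R) (rf_space E) U g =
    ext3 (@fms_integral R) (rf_space E) U h.

(** [g] is the conditional expectation of [h] given the [i]-th algebra:
  uniqueness, as functions on *Omega, is part of the definition. *)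
Definition is_cond_exp (S : nsextension) (R : realType) (nu : star S nat)
    (E : reverse_filtration R nu) (i : star S nat)
    (h g : star S (R -> R)) : Prop :=
  [/\ smeasurable (Omega R) (app (rf_algs E) i) g,
      same_integrals E i g h &
      forall g' : star S (R -> R),
        smeasurable (Omega R) (app (rf_algs E) i) g' ->
        same_integrals E i g' h ->
        forall x : star S R, rel1 (Omega R) x -> app g' x = app g x].

Definition reverse_martingale (S : nsextension) (R : realType)
    (nu : star S nat) (E : reverse_filtration R nu)
    (H : star S (R * R -> R)) : Prop :=
  adapted E H /\
  forall i j : star S nat, j <=* i -> i <=* nu ->
    is_cond_exp E i (slice H (sfrac R j nu)) (slice H (sfrac R i nu)).

Definition cdf (S : nsextension) (R : realType) (nu : star S nat)
    (E : reverse_filtration R nu) (H : star S (R * R -> R))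
    (x t : star S R) : star S (\bar R) :=
  ext3 (fun M (h : R -> R) x =>
      fms_measure M [set w | Omega R w /\ h w <= x])
    (rf_space E) (slice H t) x.

Definition equivalent_in_distribution (S : nsextension) (R : realType)
    (nu : star S nat) (E : reverse_filtration R nu)
    (H1 H2 : star S (R * R -> R)) : Prop :=
  [/\ process_measurable E H1, process_measurable E H2 &
      forall x t : star S R, rel1 (Time R) t -> cdf E H1 x t = cdf E H2 x t].

(* Main.v *)
From HB Require Import structures.
Require Import Defs.
From mathcomp Require Import all_boot all_order all_algebra.
From mathcomp Require Import all_classical all_reals all_analysis.
From mathcomp Require Import measurable_realfun.

(** The row [pi_f K^j.+1] is the average of [pi_f K^j] over the three neighbours
  of a state, so if [X] is a uniform random walk on Z/eta run from time [nu]
  down to time [0], then [(pi_f K^j)(X_j)] is a reverse martingale for the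
  algebras generated by [X_nu, ..., X_j].  The walk is realised on [0, 1) by cutting it
  into [eta * 3 ^ nu] intervals of equal mass: the cell of [x] of length
  [1 / eta] gives the state at time [nu], and the further base-3 digits of [x]
  give the successive steps, so that the algebra at time [j] consists of the
  unions of intervals of length [1 / (eta * 3 ^ (nu - j))].  The point [i / eta]
  has zero digits, hence carries the constant path at [i], which makes the
  martingale an extension of [F]; and as each [X_j] is uniform, both processes
  have the same law at each time.  All this is finite combinatorics for standard
  [eta, nu > 0] and transfers to the extension. *)

Set Implicit Arguments.
Unset Strict Implicit.
Unset Printing Implicit Defensive.

Import Order.TTheory GRing.Theory Num.Theory.
Import numFieldNormedType.Exports.

Local Open Scope classical_set_scope.
Local Open Scope ring_scope.

(** * Transfer *)

Section Transfer.
Variable S : nsextension.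
Implicit Types A B C : Type.

Lemma sset_set0 A : sset set0 = set0 :> set (star S A).
Proof. by rewrite -(setICr set0) Defs.ssetI ssetC setICr. Qed.

Lemma sset_setT A : sset setT = setT :> set (star S A).
Proof. by rewrite -setC0 ssetC sset_set0 setC0. Qed.

Lemma sset_sub A (P Q : set A) (x : star S A) :
  (forall a, P a -> Q a) -> sset P x -> sset Q x.
Proof. by move=> /setIidl; rewrite setIC => <-; rewrite Defs.ssetI => -[]. Qed.

Lemma sset_and A (P Q : set A) (x : star S A) :
  sset P x -> sset Q x -> sset (fun a => P a /\ Q a) x.
Proof.
move=> Px Qx; have: (sset P `&` sset Q) x by [].
by rewrite -Defs.ssetI.
Qed.

Lemma sset_smap A B (f : A -> B) (Q : set B) (x : star S A) :
  sset Q (smap f x) = sset (fun a => Q (f a)) x.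
Proof. by rewrite (sset_preimage S f Q : sset (fun a => Q (f a)) = _). Qed.

Lemma smap_smap A B C (g : B -> C) (f : A -> B) (x : star S A) :
  smap g (smap f x) = smap (fun a => g (f a)) x.
Proof. by rewrite -smap_comp. Qed.

(* An element of *P is the image of a point of the extension of the subtype P,
   on which both functions have the same restriction. *)
Lemma eq_smap_in A B (P : set A) (f g : A -> B) (x : star S A) :
  sset P x -> (forall a, P a -> f a = g a) -> smap f x = smap g x.
Proof.
move=> Px fg; have eP : P = [set sval y | y in [set: {a | P a}]].
  by apply/seteqP; split=> [a Pa|_ [[a Pa] _ <-]] //; exists (exist _ a Pa).
move: Px; rewrite eP sset_image => -[y _ <-]; rewrite !smap_smap.
by congr smap; apply/funext => -[a Pa] /=; exact: fg.
Qed.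

Lemma spair_smap A B C (f : A -> B) (g : A -> C) (x : star S A) :
  spair (smap f x) (smap g x) = smap (fun a => (f a, g a)) x.
Proof. by rewrite -[RHS]spair_eta !smap_smap. Qed.

Lemma spairP A B (x : star S A) (y : star S B) :
  exists z : star S (A * B), x = smap fst z /\ y = smap snd z.
Proof. by exists (spair x y); rewrite smap_fst smap_snd. Qed.

Lemma star_unitP (x : star S unit) : x = spoint.
Proof.
rewrite -(smap_fst x spoint) -[RHS](smap_snd x).
by congr smap; apply/funext => -[[] []].
Qed.

(** A standard element is the image of any given [x] under a constant function, so it can be merged
    with other terms at [x]. *)
Lemma stdE A B (b : B) (x : star S A) : std S b = smap (fun=> b) x.
Proof.
by rewrite /std -(star_unitP (smap (fun=> tt) x)) smap_smap.
Qed.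

(** Equality transfers because the diagonal is the image of [b] under the map to [(b, b)]; hence the
    extension of the diagonal contains every pair of equal elements. *)
Lemma smap_eqP A B (f g : A -> B) (x : star S A) :
  smap f x = smap g x <-> sset (fun a => f a = g a) x.
Proof.
split=> [fg|]; last by move=> /eq_smap_in; apply.
pose D : set (B * B) := [set (b, b) | b in [set: B]].
apply: (@sset_sub _ (fun a => D (f a, g a))) => [a [b _ [<- <-]]//|].
rewrite -(sset_smap (fun a => (f a, g a))) -spair_smap fg spair_smap.
by rewrite sset_image; exists (smap g x); rewrite ?sset_setT ?smap_smap.
Qed.

Lemma sset_exists A B (P : A -> B -> Prop) (x : star S A) :
  sset (fun a => exists b, P a b) x <->
  exists y, sset (fun p => P p.1 p.2) (spair x y).
Proof.
have -> : (fun a => exists b, P a b) = fst @` [set p | P p.1 p.2].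
  apply/seteqP; split=> [a [b Pab]|_ [[a b] Pab <-]]; last by exists b.
  by exists (a, b).
rewrite sset_image; split=> [[z Pz <-]|[y Py]].
  by exists (smap snd z); rewrite spair_eta.
by exists (spair x y) => //; rewrite smap_fst.
Qed.

(** With [B] a type of sets or functions, a standard quantifier over all of them becomes one over
    the internal ones. *)
Lemma sset_forall A B (P : A -> B -> Prop) (x : star S A) :
  sset (fun a => forall b, P a b) x <->
  forall y, sset (fun p => P p.1 p.2) (spair x y).
Proof.
have -> : (fun a => forall b, P a b) = ~` (fun a => exists b, ~ P a b).
  apply/funext => a; apply/propext; split=> [Pa [b]|Pa b]; first exact.
  by apply: contrapT => Pab; apply: Pa; exists b.
rewrite ssetC; split=> [nP y|Py].
  apply: contrapT => nPy; apply: nP; apply/sset_exists; exists y.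
  by rewrite (ssetC S (fun p => P p.1 p.2) : sset (fun p => ~ P p.1 p.2) = _).
case/sset_exists => y.
rewrite (ssetC S (fun p => P p.1 p.2) : sset (fun p => ~ P p.1 p.2) = _).
exact.
Qed.

Lemma sset_impl A (P Q : set A) (x : star S A) :
  sset (fun a => P a -> Q a) x <-> (sset P x -> sset Q x).
Proof.
have -> : (fun a => P a -> Q a) = ~` (P `&` ~` Q).
  apply/funext => a; apply/propext; split=> [PQ [/PQ]//|nPQ Pa].
  by apply: contrapT => nQa; apply: nPQ.
rewrite ssetC Defs.ssetI ssetC; split=> [nPQ Px|PQ [/PQ]//].
by apply: contrapT => nQx; apply: nPQ.
Qed.

(* Finitely many elements of extensions are always images of a single [x]; these
   rules then merge a formula about them into one standard predicate at [x]. *)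
Section Normalisation.
Variables (A : Type) (x : star S A).

Lemma ext1_smap B C (g : B -> C) (f : A -> B) :
  ext1 g (smap f x) = smap (fun a => g (f a)) x.
Proof. exact: smap_smap. Qed.

Lemma ext2_smap B C D (g : B -> C -> D) (f1 : A -> B) (f2 : A -> C) :
  ext2 g (smap f1 x) (smap f2 x) = smap (fun a => g (f1 a) (f2 a)) x.
Proof. by rewrite /ext2 spair_smap smap_smap. Qed.

Lemma ext3_smap B C D E (g : B -> C -> D -> E) (f1 : A -> B) (f2 : A -> C)
    (f3 : A -> D) :
  ext3 g (smap f1 x) (smap f2 x) (smap f3 x) =
  smap (fun a => g (f1 a) (f2 a) (f3 a)) x.
Proof. by rewrite /ext3 !spair_smap smap_smap. Qed.

Lemma rel1_smap B (P : B -> Prop) (f : A -> B) :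
  rel1 P (smap f x) = sset (fun a => P (f a)) x.
Proof. exact: sset_smap. Qed.

Lemma rel2_smap B C (P : B -> C -> Prop) (f1 : A -> B) (f2 : A -> C) :
  rel2 P (smap f1 x) (smap f2 x) = sset (fun a => P (f1 a) (f2 a)) x.
Proof. by rewrite /rel2 spair_smap sset_smap. Qed.

Lemma rel3_smap B C D (P : B -> C -> D -> Prop) (f1 : A -> B) (f2 : A -> C)
    (f3 : A -> D) :
  rel3 P (smap f1 x) (smap f2 x) (smap f3 x) =
  sset (fun a => P (f1 a) (f2 a) (f3 a)) x.
Proof. by rewrite /rel3 !spair_smap sset_smap. Qed.

Lemma app_smap B C (g : A -> B -> C) (f : A -> B) :
  app (smap g x) (smap f x) = smap (fun a => g a (f a)) x.
Proof. exact: ext2_smap. Qed.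

Lemma smem_smap B (f : A -> B) (E : A -> set B) :
  smem (smap f x) (smap E x) = sset (fun a => E a (f a)) x.
Proof. exact: rel2_smap. Qed.

Lemma sle_smap (d : Order.disp_t) (T : porderType d) (f g : A -> T) :
  sle (smap f x) (smap g x) = sset (fun a => (f a <= g a)%O) x.
Proof. exact: rel2_smap. Qed.

Lemma slt_smap (d : Order.disp_t) (T : porderType d) (f g : A -> T) :
  slt (smap f x) (smap g x) = sset (fun a => (f a < g a)%O) x.
Proof. exact: rel2_smap. Qed.

End Normalisation.

End Transfer.

(** * The chain and the digit walk *)

Section Chain.
Variable R : realType.
Implicit Types (n m d i j a k : nat) (f : R -> R).

(** The moves 0, +1 and -1 modulo [n], with [n.-1] standing for -1. Digit 0 is the move 0, so that
    zero digits give a constant path. *)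
Definition step n r := nth 0%N [:: 0%N; 1%N; n.-1] r.

(* The base-3 digits of [a], most significant first, are the successive steps
   of a walk on Z/n whose starting point is the remaining leading part. *)
Fixpoint walk n d a :=
  if d is d'.+1 then ((walk n d' (a %/ 3) + step n (a %% 3)) %% n)%N else a.

Definition chain n f j i :=
  row_entry (initial_row n f *m transition R n ^+ j) i.

Lemma walk_lt n d a : (a < n * 3 ^ d)%N -> (walk n d a < n)%N.
Proof.
case: d => [|d]; first by rewrite muln1.
by case: n => [|n]; rewrite ?mul0n //= ltn_pmod.
Qed.

Lemma walk_const n d i : (i < n)%N -> walk n d (i * 3 ^ d) = i.
Proof.
move=> i_lt; elim: d => [|d IHd] /=; first by rewrite muln1.
by rewrite expnSr mulnA mulnK // IHd modnMl addn0 modn_small.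
Qed.

(** A row times the matrix sums over the states leading to [i]; since [k] is the predecessor of [l]
    exactly when [l] is the successor of [k], these are again the neighbours of [i]. When neighbours
    coincide for small [n], both sides count them with multiplicity. *)
Lemma row_entry_transition n (w : 'rV[R]_n) i : (i < n)%N ->
  row_entry (w *m transition R n) i =
  (\sum_(r < 3) row_entry w ((i + step n r) %% n)) / 3%:R.
Proof.
case: n w => // n w i_lt.
have entryE (v : 'rV[R]_n.+1) (k : 'I_n.+1) : row_entry v k = v 0 k.
  by rewrite /row_entry insubT //= => lt_k; congr (v 0 _); apply: val_inj.
pose k := Ordinal i_lt.
have entry_at (l : 'I_n.+1) a : a = l -> row_entry w a = w 0 l.
  by move=> ->; exact: entryE.
rewrite !big_ord_recr big_ord0 /= add0r.
rewrite (entry_at k); last by rewrite addn0 modn_small.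
rewrite (entry_at (ordS k)); last by rewrite addn1.
rewrite (entry_at (ord_pred k)); last by rewrite /= addnS.
rewrite (entryE _ k : row_entry _ i = _) mxE.
under eq_bigr => l _ do rewrite mxE mulrA natrD natrD !mulrDr.
rewrite -mulr_suml !big_split /=; congr (_ / _).
have selE (P : pred 'I_n.+1) l : (forall x, P x = (x == l)) ->
    \sum_x w 0 x * (P x)%:R = w 0 l.
  move=> Pl; rewrite (bigD1 l) //= Pl eqxx mulr1 big1 ?addr0 // => x /negPf xl.
  by rewrite Pl xl mulr0.
rewrite (selE _ (ordS k)) => [|x].
  rewrite (selE _ k) => [|x]; last by rewrite eq_sym.
  rewrite (selE _ (ord_pred k)) => [|x].
    by rewrite [w 0 (ordS k) + _]addrC.
  by apply/eqP/eqP => ->; rewrite ?ordSK ?ord_predK.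
by apply/eqP/eqP => ->; rewrite ?ordSK ?ord_predK.
Qed.

Lemma chainS n f j i : (i < n)%N ->
  chain n f j.+1 i = (\sum_(r < 3) chain n f j ((i + step n r) %% n)) / 3%:R.
Proof.
by move=> i_lt; rewrite /chain exprSr -[_ * _]/(_ *m _) mulmxA
  row_entry_transition.
Qed.

Lemma sum_mul N b (G : nat -> R) :
  \sum_(k < N * b) G k = \sum_(a < N) \sum_(r < b) G (a * b + r)%N.
Proof.
rewrite -(big_mkord xpredT G) big_nat_mul big_mkord; apply: eq_bigr => a _.
rewrite mulSn -{1}[(a * b)%N]add0n big_addn addnK big_mkord.
by apply: eq_bigr => r _; rewrite addnC.
Qed.

Lemma sum_divn N b (G : nat -> R) : (0 < b)%N ->
  \sum_(k < N * b) G (k %/ b)%N = (\sum_(a < N) G a) *+ b.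
Proof.
move=> b_gt0; rewrite (sum_mul _ _ (fun k => G (k %/ b)%N)) -sumrMnl.
apply: eq_bigr => a _.
under eq_bigr => r _ do rewrite divnMDl // divn_small // addn0.
by rewrite sumr_const card_ord.
Qed.

Lemma sum_rot n c (g : nat -> R) :
  \sum_(i < n) g ((i + c) %% n)%N = \sum_(i < n) g i.
Proof.
case: n => [|n]; first by rewrite !big_ord0.
rewrite [RHS](reindex_inj (addIr (inZp c))) /=.
by apply: eq_bigr => i _; rewrite modnDmr.
Qed.

(** The state reached is uniformly distributed: the starting point is uniform, and for each value of
    the last digit the last step is a translation of Z/n, which permutes the states. *)
Lemma sum_walk n d (g : nat -> R) :
  \sum_(a < n * 3 ^ d) g (walk n d a) = (\sum_(i < n) g i) *+ 3 ^ d.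
Proof.
elim: d g => [|d IHd] g.
  by rewrite -(big_mkord xpredT (fun a => g (walk n 0 a))) /= muln1 big_mkord.
rewrite expnSr mulnA (sum_mul _ _ (fun a => g (walk n d.+1 a))) exchange_big /=.
transitivity (\sum_(r < 3) (\sum_(i < n) g i) *+ 3 ^ d).
  apply: eq_bigr => r _; rewrite -(sum_rot n (step n r) g).
  rewrite -(IHd (fun i => g ((i + step n r) %% n)%N)); apply: eq_bigr => a _.
  by rewrite divnMDl // divn_small // addn0 modnMDl (modn_small (ltn_ord r)).
by rewrite sumr_const card_ord mulrnA.
Qed.

(** The martingale identity for one step: the three subcells of cell [b] correspond to the three
    moves from its state, their values average to the value at time [j.+1], and the weight [u]
    depends only on [b]. *)
Lemma sum_chain_walk n f j d (u : nat -> R) :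
  \sum_(a < n * 3 ^ d.+1) u (a %/ 3)%N * chain n f j (walk n d.+1 a) =
  (\sum_(b < n * 3 ^ d) u b * chain n f j.+1 (walk n d b)) *+ 3.
Proof.
rewrite expnSr mulnA (sum_mul _ _ (fun a => u (a %/ 3)%N *
  chain n f j (walk n d.+1 a))) -sumrMnl; apply: eq_bigr => b _.
rewrite chainS ?walk_lt // mulrA -mulrnAr -[3%:R^-1 *+ 3]mulr_natr mulVf //.
rewrite mulr1 mulr_sumr; apply: eq_bigr => r _ /=.
by rewrite divnMDl // divn_small // addn0 modnMDl (modn_small (ltn_ord r)).
Qed.

(** With [u] the indicator of a set of level-[i] cells, this is the equality of integrals that
    defines the conditional expectation. *)
Lemma chain_martingale n m f i j (u : nat -> R) : (j <= i <= m)%N ->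
  \sum_(k < n * 3 ^ m)
    u (k %/ 3 ^ i)%N * chain n f j (walk n (m - j) (k %/ 3 ^ j)) =
  \sum_(k < n * 3 ^ m)
    u (k %/ 3 ^ i)%N * chain n f i (walk n (m - i) (k %/ 3 ^ i)).
Proof.
case/andP; elim: i => [|i IHi] in u *; first by rewrite leqn0 => /eqP ->.
rewrite leq_eqVlt ltnS => /predU1P[-> //|ji] im.
(* A weight depending on the cell of level [i.+1] also depends only on the finer cell of level [i],
   so the induction hypothesis leads from time [j] to time [i]; one step remains. *)
transitivity (\sum_(k < n * 3 ^ m) u (k %/ 3 ^ i %/ 3)%N *
    chain n f i (walk n (m - i) (k %/ 3 ^ i))).
  rewrite -(IHi (fun a => u (a %/ 3)%N) ji (ltnW im)).
  by apply: eq_bigr => k _; rewrite -divnMA -expnSr.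
have mE e : (e <= m)%N -> (n * 3 ^ m = n * 3 ^ (m - e) * 3 ^ e)%N.
  by move=> em; rewrite -mulnA -expnD subnK.
(* Both summands are constant on blocks of finest cells, so each sum collapses to the grid of its
   own level. *)
rewrite (mE i (ltnW im)) (sum_divn _ (fun a => u (a %/ 3)%N *
  chain n f i (walk n (m - i) a))) ?expn_gt0 //.
rewrite -(mE i (ltnW im)) (mE i.+1 im) (sum_divn _ (fun a => u a *
  chain n f i.+1 (walk n (m - i.+1) a))) ?expn_gt0 //.
by rewrite -(subnSK im) sum_chain_walk -mulrnA -expnS.
Qed.

End Chain.

(** * Grids on [0, 1) *)

Section Grid.
Variable R : realType.
Implicit Types (N b k : nat) (x y : R) (A U : set R) (h : R -> R).

Definition grid_alg N := unions_of (cells R N).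

(** The condition [0 <= x] is there because [Num.truncn] sends negative numbers to 0. *)
Lemma cellE N k x : (0 < N)%N ->
  (k%:R / N%:R <= x < k.+1%:R / N%:R) =
  (0 <= x) && (Num.truncn (x * N%:R) == k).
Proof.
move=> N_gt0; have N_gt0' : (0 < N%:R :> R) by rewrite ltr0n.
rewrite ler_pdivrMr // ltr_pdivlMr //; have [x_ge0|x_lt0] /= := leP 0 x.
  by rewrite truncn_eq ?mulr_ge0.
apply/negbTE; rewrite negb_and -!real_ltNge ?num_real //.
by rewrite (lt_le_trans _ (ler0n _ _)) // pmulr_llt0.
Qed.

Lemma truncn_grid N k : (0 < N)%N -> Num.truncn (k%:R / N%:R * N%:R : R) = k.
Proof. by move=> N_gt0; rewrite divfK ?natrK // pnatr_eq0 -lt0n. Qed.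

(** Passing to a coarser grid divides the cell index; with [b] a power of 3 this drops the last
    base-3 digits. *)
Lemma truncn_divn N b x : (0 < N)%N -> (0 < b)%N -> 0 <= x ->
  (Num.truncn (x * (N * b)%:R) %/ b)%N = Num.truncn (x * N%:R).
Proof.
move=> N_gt0 b_gt0 x_ge0; have b_gt0' : (0 < b%:R :> R) by rewrite ltr0n.
have /andP[] := @truncn_itv R (x * (N * b)%:R) (mulr_ge0 x_ge0 (ler0n _ _)).
set k := Num.truncn _; rewrite natrM mulrA => k_le lt_k.
apply/esym/truncn_def; rewrite -(ler_pM2r b_gt0') -(ltr_pM2r b_gt0').
rewrite -!natrM (le_trans _ k_le) ?ler_nat ?leq_divM //=.
by rewrite (lt_le_trans lt_k) // ler_nat ltn_ceil.
Qed.

Lemma truncn_Omega N x : (0 < N)%N -> Omega R x ->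
  (Num.truncn (x * N%:R) < N)%N.
Proof.
move=> N_gt0 /andP[x_ge0 x_lt1]; rewrite truncn_lt_nat ?mulr_ge0 //.
by rewrite gtr_pMl // ltr0n.
Qed.

Lemma Omega_grid N k : (k < N)%N -> Omega R (k%:R / N%:R).
Proof.
move=> kN; rewrite /Omega /= divr_ge0 //= ltr_pdivrMr ?mul1r ?ltr_nat //.
by rewrite ltr0n (leq_ltn_trans _ kN).
Qed.

(** Encodes a union of cells by a set of indices, so that set operations can be carried out on
    [set nat]. *)
Lemma grid_algP N A : (0 < N)%N ->
  grid_alg N A <->
  exists P : set nat, A = [set x | Omega R x /\ P (Num.truncn (x * N%:R))].
Proof.
move=> N_gt0; split=> [[D Dcells <-]|[P ->]].
  exists (fun k => D [set x | k%:R / N%:R <= x < k.+1%:R / N%:R]).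
  apply/seteqP; split=> x /=.
    case=> C DC; have [k /= kN Ck] := Dcells _ DC.
    rewrite -Ck /= cellE // => /andP[x_ge0 /eqP xk].
    split; last by rewrite xk Ck.
    rewrite /Omega /= x_ge0 /= -(ltr_pM2r (_ : 0 < N%:R)) ?ltr0n // mul1r.
    by rewrite -truncn_lt_nat ?xk // mulr_ge0.
  case=> Ox DC; eexists; first exact: DC.
  by rewrite /= cellE // eqxx; case/andP: Ox => ->.
pose D := [set C : set R | exists2 k, (k < N)%N /\ P k &
  C = [set x : R | k%:R / N%:R <= x < k.+1%:R / N%:R]].
exists D => [C [k [kN _] ->]|]; first by exists k.
apply/seteqP; split=> [x [C [k [kN Pk] ->]] /=|x [Ox Px]].
  rewrite cellE // => /andP[x_ge0 /eqP xk]; rewrite xk; split=> //.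
  rewrite /Omega /= x_ge0 /= -(ltr_pM2r (_ : 0 < N%:R)) ?ltr0n // mul1r.
  by rewrite -truncn_lt_nat ?xk // mulr_ge0.
eexists.
  by exists (Num.truncn (x * N%:R)); first by rewrite truncn_Omega.
by rewrite /= cellE // eqxx; case/andP: Ox => ->.
Qed.

Lemma grid_alg_saturated N A x y : (0 < N)%N -> grid_alg N A ->
  Omega R y -> Num.truncn (x * N%:R) = Num.truncn (y * N%:R) -> A x -> A y.
Proof. by move=> N_gt0 /grid_algP -/(_ N_gt0)[P ->] Oy /= -> []. Qed.

Lemma sub_grid_alg N b : (0 < N)%N -> (0 < b)%N ->
  grid_alg N `<=` grid_alg (N * b).
Proof.
move=> N_gt0 b_gt0 A /(grid_algP _ N_gt0)[P ->].
apply/grid_algP; rewrite ?muln_gt0 ?N_gt0 //; exists (fun k => P (k %/ b)%N).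
apply/seteqP; split=> x /= [Ox]; case/andP: (Ox) => x_ge0 _.
  by rewrite truncn_divn.
by rewrite truncn_divn.
Qed.

Lemma grid_alg_sigma_algebra N : (0 < N)%N ->
  sigma_algebra_on (Omega R) (grid_alg N).
Proof.
move=> N_gt0; split; last first.
  by move=> A /(grid_algP _ N_gt0)[P ->] x [].
split=> [|A /(grid_algP _ N_gt0)[P ->]|A GA].
- apply/(grid_algP _ N_gt0); exists set0.
  by apply/seteqP; split=> x // [].
- apply/(grid_algP _ N_gt0); exists (~` P); apply/seteqP; split=> x [Ox nP].
    by split=> // Px; apply: nP.
  by split=> // -[].
- have /choice[P AE] k := (grid_algP _ N_gt0).1 (GA k).
  apply/(grid_algP _ N_gt0); exists (\bigcup_k P k); apply/seteqP; split=> x.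
    by case=> k _; rewrite AE => -[Ox Px]; split=> //; exists k.
  by case=> Ox [k _ Px]; exists k => //; rewrite AE.
Qed.

Lemma grid_alg_finite N : (0 < N)%N -> finite_set (grid_alg N).
Proof.
move=> N_gt0.
pose union_in (s : {set 'I_N}) : set R :=
  [set x | Omega R x /\ exists2 k : 'I_N, k \in s & Num.truncn (x * N%:R) = k].
apply: (@sub_finite_set _ _ (union_in @` setT)); last first.
  exact/finite_image/finite_finset.
move=> A /(grid_algP _ N_gt0)[P ->].
exists [set k : 'I_N | `[< P k >]]%SET => //.
apply/seteqP; split=> x /= [Ox].
  by case=> k; rewrite inE => /asboolP + ->.
move=> Px; split=> //; exists (Ordinal (truncn_Omega N_gt0 Ox)) => //.
by rewrite inE; exact/asboolP.
Qed.

(** Unit masses at the left end points of the cells. On [grid_alg N] with [N] positive this is [N]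
    times Lebesgue measure, and integrals become finite sums. *)
Definition grid_measure N : set (g_sigma_algebraType (grid_alg N)) -> \bar R :=
  msum (fun k => \d_(k%:R / N%:R : g_sigma_algebraType (grid_alg N))) N.

HB.instance Definition _ N := Measure.on (@grid_measure N).

Let grid_measure_fin N : fin_num_fun (@grid_measure N).
Proof.
move=> A mA; rewrite /grid_measure /msum sum_fin_num; apply/allP => e.
by case/mapP => k _ ->.
Qed.

HB.instance Definition _ N :=
  Measure_isFinite.Build _ _ _ (@grid_measure N) (@grid_measure_fin N).

(* [N.-1.+1] is [N] for [N > 0]; with no cells at all, the sigma-algebra laws
   would fail. *)
Definition grid_space N : fin_measure_space R :=
  FinMeasureSpace (grid_alg_sigma_algebra (ltn0Sn N.-1))
    (grid_alg_finite (ltn0Sn N.-1)) (@grid_measure N.-1.+1).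

(** The standard predicate whose extension is [smeasurable]. *)
Definition measurable_on T (D : set T) (E : set (set T)) (g : T -> R) :=
  forall B : set R, measurable B -> E (D `&` g @^-1` B).

Lemma grid_integral N U h : (0 < N)%N ->
  grid_alg N U -> measurable_on (Omega R) (grid_alg N) h ->
  fms_integral (grid_space N) U h =
  (\sum_(k < N) (k%:R / N%:R \in U)%:R * h (k%:R / N%:R))%:E.
Proof.
case: N => // N N_gt0 GU mh; rewrite /fms_integral /=.
pose T : measurableType _ := g_sigma_algebraType (grid_alg N.+1).
have mU : measurable (U : set T) by exact: sub_sigma_algebra.
have mhU : measurable_fun (U : set T) (EFin \o h : T -> \bar R).
  apply/measurable_EFinP => _ B mB; apply: sub_sigma_algebra.
  have UO : U `<=` Omega R := (grid_alg_sigma_algebra N_gt0).2 _ GU.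
  have /(grid_algP _ N_gt0)[P PE] := mh _ mB.
  have /(grid_algP _ N_gt0)[Q QE] := GU.
  apply/(grid_algP _ N_gt0); exists (Q `&` P); apply/seteqP; split=> x /=.
    move=> [Ux hx]; have := conj (UO _ Ux) hx.
    rewrite -[_ /\ _]/((Omega R `&` h @^-1` B) x) PE => -[Ox Px].
    by move: Ux; rewrite QE => -[].
  move=> [Ox [Qx Px]]; have: U x by rewrite QE.
  have: (Omega R `&` h @^-1` B) x by rewrite PE.
  by case.
have mpos := measurable_funepos mhU; have mneg := measurable_funeneg mhU.
(* Integrals against a sum of measures are split for nonnegative functions, hence the detour through
   the positive and negative parts; each Dirac mass then evaluates at its point. *)
rewrite integralE !ge0_integral_measure_sum //.
pose p (k : nat) : R := k%:R / N.+1%:R.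
transitivity ((\sum_(k < N.+1) (p k \in U)%:R * h^\+ (p k))%:E -
              (\sum_(k < N.+1) (p k \in U)%:R * h^\- (p k))%:E)%E.
  rewrite -!sumEFin; congr (_ - _)%E; apply: eq_bigr => k _.
    apply: etrans (integral_dirac _ mU mpos) _.
    by rewrite diracE EFinM funerpos.
  apply: etrans (integral_dirac _ mU mneg) _.
  by rewrite diracE EFinM funerneg.
rewrite -EFinB -sumrB; congr EFin; apply: eq_bigr => k _.
by rewrite -mulrBr -[in RHS](funrposBneg h).
Qed.

End Grid.

Arguments grid_alg : clear implicits.
Arguments grid_space : clear implicits.

(** * Functions measurable for the grid and time algebras *)

Section GridMeasurability.
Variable R : realType.
Implicit Types (n m b i j k N : nat) (x y t : R) (A U : set R) (f g h : R -> R).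

Lemma measurable_on_sub T (D : set T) (E E' : set (set T)) (g : T -> R) :
  E `<=` E' -> measurable_on D E g -> measurable_on D E' g.
Proof. by move=> EE' mg B /mg /EE'. Qed.

Lemma eq_measurable_on T (D : set T) (E : set (set T)) (g h : T -> R) :
  (forall z, D z -> g z = h z) -> measurable_on D E g -> measurable_on D E h.
Proof.
move=> gh mg B /mg; congr E; apply/seteqP; split=> z [Dz] /=.
  by rewrite gh.
by rewrite -gh.
Qed.

Lemma measurable_on_grid N (G : nat -> R) : (0 < N)%N ->
  measurable_on (Omega R) (grid_alg R N)
    (fun x => G (Num.truncn (x * N%:R))).
Proof. by move=> N_gt0 B mB; apply/grid_algP => //; exists (G @^-1` B). Qed.

(** The preimage of the singleton of [h x] is a union of cells, so with [x] it contains the whole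
    cell of [x]. *)
Lemma grid_measurable_eq N h x y : (0 < N)%N ->
  measurable_on (Omega R) (grid_alg R N) h -> Omega R x -> Omega R y ->
  Num.truncn (x * N%:R) = Num.truncn (y * N%:R) -> h y = h x.
Proof.
move=> N_gt0 mh Ox Oy xy.
have Gh := mh [set h x] (measurable_set1 _).
by have [] : (Omega R `&` h @^-1` [set h x]) y
  by exact: (grid_alg_saturated N_gt0 Gh Oy xy).
Qed.

(** This gives uniqueness of the conditional expectation. The test set is the coarse cell of [x]:
    both functions are constant on it, and its mass is not zero. *)
Lemma grid_integral_inj N b g h x : (0 < N)%N -> (0 < b)%N ->
  measurable_on (Omega R) (grid_alg R N) g ->
  measurable_on (Omega R) (grid_alg R N) h ->
  (forall U, grid_alg R N U ->
    fms_integral (grid_space R (N * b)) U g =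
    fms_integral (grid_space R (N * b)) U h) ->
  Omega R x -> g x = h x.
Proof.
move=> N_gt0 b_gt0 mg mh gh Ox.
have Nb_gt0 : (0 < N * b)%N by rewrite muln_gt0 N_gt0.
pose U := [set y | Omega R y /\ Num.truncn (y * N%:R) = Num.truncn (x * N%:R)].
have GU : grid_alg R N U.
  by apply/grid_algP => //; exists [set Num.truncn (x * N%:R)].
pose p k : R := k%:R / (N * b)%:R.
have intE w : measurable_on (Omega R) (grid_alg R N) w ->
    fms_integral (grid_space R (N * b)) U w =
    ((\sum_(k < N * b) (p k \in U)%:R) * w x)%:E.
  move=> mw; rewrite grid_integral //; last 2 first.
  - exact: sub_grid_alg.
  - exact: measurable_on_sub (sub_grid_alg N_gt0 b_gt0) mw.
  congr EFin; rewrite mulr_suml; apply: eq_bigr => k _; rewrite -/(p k).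
  have [|_] := boolP (p k \in U); last by rewrite !mul0r.
  by rewrite inE => -[Opk pkx]; rewrite (grid_measurable_eq N_gt0 mw Opk Ox).
have := gh U GU; rewrite !intE // => -[]; apply: mulfI.
rewrite -natr_sum pnatr_eq0 -lt0n.
(* The mass of [U] counts the fine grid points in it; the left end point of the fine cell of [x] is
   one of them. *)
rewrite (bigD1 (Ordinal (truncn_Omega Nb_gt0 Ox))) //= ltn_addr //.
rewrite lt0b inE; split; first by apply: Omega_grid; exact: truncn_Omega.
have /andP[x_ge0 _] := Ox.
rewrite -(truncn_divn N_gt0 b_gt0) ?truncn_grid ?truncn_divn //.
by rewrite divr_ge0.
Qed.

Definition time_alg m := unions_of (cells R m `|` [set [set 1]]).

Lemma time_alg_level m j : (0 < m)%N ->
  time_alg m [set t | Time R t /\ Num.truncn (t * m%:R) = j].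
Proof.
move=> m_gt0; have m_gt0' : (0 < m%:R :> R) by rewrite ltr0n.
(* On [0, 1] the index is [m] only at the point 1, which is the extra generator; below [m] the level
   set is a cell, and above [m] it is empty. *)
have [jm|mj|->] := ltngtP j m.
- exists [set [set t : R | j%:R / m%:R <= t < j.+1%:R / m%:R]].
    by move=> _ ->; left; exists j.
  rewrite bigcup_set1; apply/seteqP; split=> t /=.
    rewrite cellE // => /andP[t_ge0 /eqP tj]; split=> //.
    rewrite /Time /= t_ge0 -(ler_pM2r m_gt0') mul1r ltW //.
    by rewrite -truncn_lt_nat ?tj // mulr_ge0.
  by case=> /andP[t_ge0 _] tj; rewrite cellE // t_ge0 tj /=.
- exists set0 => //; rewrite bigcup_set0; apply/esym/seteqP; split=> t // [].
  move=> /andP[t_ge0 t_le1] tj; move: mj; rewrite -tj truncn_gt_nat.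
  rewrite leNgt (le_lt_trans (_ : _ <= m%:R)) ?ltr_nat //.
  by rewrite -[leRHS]mul1r ler_pM2r.
- exists [set [set 1]]; first by move=> _ ->; right.
  rewrite bigcup_set1; apply/seteqP; split=> t /=.
    by move=> ->; rewrite /Time /= ler01 lexx mul1r natrK.
  case=> /andP[t_ge0 t_le1] tm; apply/le_anti; rewrite t_le1 /=.
  by rewrite -(ler_pM2r m_gt0') mul1r -truncn_ge_nat ?tm // mulr_ge0.
Qed.

(** Only countably many pairs of indices occur, so each preimage is a countable union of rectangles
    [C k j], empty when [G k j] is outside [B]. *)
Lemma measurable_on_prod N m (G : nat -> nat -> R) : (0 < N)%N -> (0 < m)%N ->
  measurable_on (Omega R `*` Time R)
    <<s Omega R `*` Time R,
      [set A `*` B | A in grid_alg R N & B in time_alg m] >>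
    (fun p => G (Num.truncn (p.1 * N%:R)) (Num.truncn (p.2 * m%:R))).
Proof.
move=> N_gt0 m_gt0 B mB.
pose C k j : set (R * R) := [set p | B (G k j)] `&`
  ([set x | Omega R x /\ Num.truncn (x * N%:R) = k] `*`
   [set t | Time R t /\ Num.truncn (t * m%:R) = j]).
rewrite (_ : _ `&` _ = \bigcup_k \bigcup_j C k j); last first.
  apply/seteqP; split=> [[x t] /= [[Ox Tt] Bxt]|[x t] [k _ [j _]]].
    by exists (Num.truncn (x * N%:R)) => //; exists (Num.truncn (t * m%:R)).
  by case=> /= Bkj [[Ox xk] [Tt tj]]; rewrite xk tj.
apply: sigma_algebra_bigcup => k; apply: sigma_algebra_bigcup => j.
rewrite /C; have [Bkj|nBkj] := pselect (B (G k j)); last first.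
  rewrite (_ : _ `&` _ = set0); first exact: sigma_algebra0.
  by apply/seteqP; split=> z // [].
rewrite (_ : [set p | _] = setT) ?setTI; last by apply/seteqP; split.
apply: sub_sigma_algebra; eexists; last eexists; last reflexivity.
  by apply/grid_algP => //; exists [set k].
exact: time_alg_level.
Qed.

End GridMeasurability.

Arguments time_alg : clear implicits.

(** * The lifted chain at standard parameters *)

Section LiftedChain.
Variable R : realType.
Implicit Types (n m b i j k N : nat) (x y t : R) (A U : set R) (f g h : R -> R).

(* The walk of depth [m - j] read off the cell of [x] is the state at time
   [j]. *)
Definition lifted n m f (p : R * R) :=
  let j := Num.truncn (p.2 * m%:R) in
  chain n f j (walk n (m - j) (Num.truncn (p.1 * (n * 3 ^ (m - j))%:R))).

Definition level_alg n m i := grid_alg R (n * 3 ^ (m - i)).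

Lemma truncn_Time m t : Time R t -> (Num.truncn (t * m%:R) <= m)%N.
Proof.
move=> /andP[t_ge0 t_le1]; rewrite truncn_le_nat.
by rewrite (@le_lt_trans _ _ m%:R) ?ltr_nat // ler_piMl.
Qed.

Lemma grid_space_measure N A : (0 < N)%N ->
  fms_measure (grid_space R N) A = (\sum_(k < N) (k%:R / N%:R \in A)%:R)%:E.
Proof.
case: N => // N _; rewrite -sumEFin; apply: eq_bigr => k _.
exact: diracE.
Qed.

Section Standard.
Variables (n m : nat) (f : R -> R).
Hypotheses (n_gt0 : (0 < n)%N) (m_gt0 : (0 < m)%N).

Let size_gt0 d : (0 < n * 3 ^ d)%N.
Proof. by rewrite muln_gt0 n_gt0 expn_gt0. Qed.

Let sizeE i : (i <= m)%N -> (n * 3 ^ m = n * 3 ^ (m - i) * 3 ^ i)%N.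
Proof. by move=> im; rewrite -mulnA -expnD subnK. Qed.

Lemma level_alg_decreasing i j : (j <= i)%N ->
  level_alg n m i `<=` level_alg n m j.
Proof.
move=> ji; rewrite /level_alg -(subnK (leq_sub2l m ji)) addnC expnD mulnA.
by apply: sub_grid_alg; rewrite ?expn_gt0.
Qed.

Lemma lifted_grid i j : (i < n)%N ->
  lifted n m f (i%:R / n%:R, j%:R / m%:R) =
  evolution n m f (i%:R / n%:R, j%:R / m%:R).
Proof.
move=> i_lt; rewrite /lifted /evolution /= !truncn_grid //; congr chain.
(* In the grid refined by [3 ^ d], the point [i / n] has index [i * 3 ^ d]: all its digits vanish
   and the walk stays at [i]. *)
set d := (m - j)%N; rewrite [X in walk n d X](_ : _ = (i * 3 ^ d)%N).
  exact: walk_const.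
by rewrite natrM mulrA divfK ?pnatr_eq0 -?lt0n // -natrM natrK.
Qed.

Lemma lifted_measurable :
  measurable_on (Omega R `*` Time R)
    <<s Omega R `*` Time R,
      [set A `*` B | A in level_alg n m 0 & B in time_alg R m] >>
    (lifted n m f).
Proof.
rewrite /level_alg subn0.
apply: eq_measurable_on (measurable_on_prod
  (fun k j => chain n f j (walk n (m - j) (k %/ 3 ^ j))) _ _) => //.
move=> [x t] [/= /andP[x_ge0 _] Tt]; rewrite /lifted /=.
by rewrite (sizeE (truncn_Time m Tt)) truncn_divn ?expn_gt0.
Qed.

Lemma evolution_measurable :
  measurable_on (Omega R `*` Time R)
    <<s Omega R `*` Time R,
      [set A `*` B | A in level_alg n m 0 & B in time_alg R m] >>
    (evolution n m f).
Proof.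
rewrite /level_alg subn0.
apply: eq_measurable_on (measurable_on_prod
  (fun k j => chain n f j (k %/ 3 ^ m)) _ _) => //.
move=> [x t] [/= /andP[x_ge0 _] _]; rewrite /evolution /=.
by rewrite truncn_divn ?expn_gt0.
Qed.

Lemma lifted_slice i x : lifted n m f (x, i%:R / m%:R) =
  chain n f i (walk n (m - i) (Num.truncn (x * (n * 3 ^ (m - i))%:R))).
Proof. by rewrite /lifted /= truncn_grid. Qed.

Lemma lifted_adapted i :
  measurable_on (Omega R) (level_alg n m i)
    (fun x => lifted n m f (x, i%:R / m%:R)).
Proof.
apply: eq_measurable_on (measurable_on_grid
  (fun k => chain n f i (walk n (m - i) k)) _) => // x _.
by rewrite lifted_slice.
Qed.

Lemma lifted_same_integrals i j U : (j <= i)%N -> (i <= m)%N ->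
  level_alg n m i U ->
  fms_integral (grid_space R (n * 3 ^ m)) U
    (fun x => lifted n m f (x, i%:R / m%:R)) =
  fms_integral (grid_space R (n * 3 ^ m)) U
    (fun x => lifted n m f (x, j%:R / m%:R)).
Proof.
move=> ji im GU; have jm := leq_trans ji im.
have sub0 l : level_alg n m l `<=` grid_alg R (n * 3 ^ m).
  by move: (level_alg_decreasing (leq0n l)); rewrite {2}/level_alg subn0.
rewrite !grid_integral //; try exact: sub0 GU.
- congr EFin.
  have /(grid_algP _ (size_gt0 _))[P UE] := GU.
  (* The mass point of the finest cell [k] lies in the cell of level [l] obtained by dropping the
     last [l] digits of [k]. *)
  have index l k : (l <= m)%N -> Num.truncn (k%:R / (n * 3 ^ m)%:R *
      (n * 3 ^ (m - l))%:R : R) = (k %/ 3 ^ l)%N.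
    move=> lm; rewrite -(truncn_divn (size_gt0 _) (expn_gt0 3 l)) ?divr_ge0 //.
    by rewrite -sizeE // truncn_grid.
  have memU (k : 'I_(n * 3 ^ m)) : (k%:R / (n * 3 ^ m)%:R \in U) =
      `[< P (k %/ 3 ^ i)%N >].
    apply/idP/asboolP; rewrite inE UE /= index //; first by case.
    by split=> //; exact: Omega_grid.
  under eq_bigr do rewrite memU lifted_slice index //.
  under [RHS]eq_bigr do rewrite memU lifted_slice index //.
  by apply/esym/(chain_martingale n f (fun a => `[< P a >]%:R)); rewrite ji.
- exact: measurable_on_sub (sub0 _) (lifted_adapted _).
- exact: measurable_on_sub (sub0 _) (lifted_adapted _).
Qed.

Lemma level_integral_inj i g h x : (i <= m)%N ->
  measurable_on (Omega R) (level_alg n m i) g ->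
  measurable_on (Omega R) (level_alg n m i) h ->
  (forall U, level_alg n m i U ->
    fms_integral (grid_space R (n * 3 ^ m)) U g =
    fms_integral (grid_space R (n * 3 ^ m)) U h) ->
  Omega R x -> g x = h x.
Proof.
move=> im; rewrite (sizeE im).
by apply: grid_integral_inj; rewrite ?expn_gt0.
Qed.

(** Both sides count finest cells. For the evolution each state owns [3 ^ m] of them. For the lifted
    chain [sum_walk] gives each state [3 ^ (m - j)] cells of level [j], each made of [3 ^ j] finest
    cells. *)
Lemma lifted_distribution x t : Time R t ->
  fms_measure (grid_space R (n * 3 ^ m))
    [set w | Omega R w /\ evolution n m f (w, t) <= x] =
  fms_measure (grid_space R (n * 3 ^ m))
    [set w | Omega R w /\ lifted n m f (w, t) <= x].
Proof.
move=> Tt; have jm := truncn_Time m Tt; set j := Num.truncn _ in jm.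
pose below i : R := (chain n f j i <= x)%R%:R.
have countE (h : R -> R) (v : nat -> nat) :
    (forall k, (k < n * 3 ^ m)%N ->
      h (k%:R / (n * 3 ^ m)%:R) = chain n f j (v k)) ->
    fms_measure (grid_space R (n * 3 ^ m)) [set w | Omega R w /\ h w <= x] =
    (\sum_(k < n * 3 ^ m) below (v k))%:E.
  move=> hv; rewrite grid_space_measure //; congr EFin; apply: eq_bigr => k _.
  rewrite /below -hv //; congr (nat_of_bool _)%:R; apply/idP/idP; rewrite inE.
    by case.
  by split=> //; exact: Omega_grid.
rewrite (countE _ (fun k => k %/ 3 ^ m)%N); last first.
  move=> k _; rewrite /evolution /= -/j -(truncn_divn n_gt0 (expn_gt0 3 m)).
    by rewrite truncn_grid.
  by rewrite divr_ge0.
rewrite (countE _ (fun k => walk n (m - j) (k %/ 3 ^ j))); last first.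
  move=> k _; rewrite /lifted /= -/j.
  rewrite -(truncn_divn (size_gt0 _) (expn_gt0 3 j)) ?divr_ge0 //.
  by rewrite -sizeE // truncn_grid.
congr EFin; rewrite (sum_divn _ below) ?expn_gt0 // (sizeE jm).
rewrite (sum_divn _ (fun a => below (walk n (m - j) a))) ?expn_gt0 //.
by rewrite sum_walk -mulrnA -expnD subnK.
Qed.

End Standard.
End LiftedChain.

Arguments level_alg : clear implicits.

(** * The nonstandard process *)

Section Process.
Variables (R : realType) (S : nsextension).

Lemma smeasurable_smap (A T : Type) (D : set T) (x : star S A)
    (E : A -> set (set T)) (h : A -> T -> R) :
  smeasurable D (smap E x) (smap h x) <->
  sset (fun a => measurable_on D (E a) (h a)) x.
Proof.
rewrite sset_forall; split=> mh B; have := mh B.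
  have [z [-> ->]] := spairP x B.
  rewrite rel1_smap !smap_smap ext2_smap smem_smap spair_smap sset_smap.
  by move=> mB; apply/sset_impl.
move=> {}mh; move: mh; have [z [-> ->]] := spairP x B.
rewrite spair_smap sset_smap rel1_smap !smap_smap ext2_smap smem_smap.
by move=> /sset_impl.
Qed.

Lemma same_integrals_smap (A : Type) (x : star S A)
    (E : A -> set (set R)) (M : A -> fin_measure_space R) (g h : A -> R -> R) :
  (forall U : star S (set R), U \in* smap E x ->
    ext3 (@fms_integral R) (smap M x) U (smap g x) =
    ext3 (@fms_integral R) (smap M x) U (smap h x)) <->
  sset (fun a => forall U, E a U ->
    fms_integral (M a) U (g a) = fms_integral (M a) U (h a)) x.
Proof.
rewrite sset_forall; split=> gh U; have := gh U; have [z [-> ->]] := spairP x U.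
  rewrite !smap_smap !ext3_smap smem_smap spair_smap sset_smap => {}gh.
  by apply/sset_impl => /gh /smap_eqP.
rewrite !smap_smap !ext3_smap smem_smap spair_smap sset_smap.
by move=> /sset_impl {}gh /gh /smap_eqP.
Qed.

(** Triples [(n, m, f)] of standard data. The nonstandard [eta], [nu] and [f] form a single element
    of the extension of this type, and the objects built from them are images of it. *)
Let param : Type := (nat * nat * (R -> R))%type.
Let valid (w : param) : Prop := (0 < w.1.1)%N /\ (0 < w.1.2)%N.

Section Filtration.
Variable q : star S param.
Hypothesis q_valid : sset valid q.

Let eta := smap (fun w : param => w.1.1) q.
Let nu := smap (fun w : param => w.1.2) q.

Let space := smap (fun w : param => grid_space R (w.1.1 * 3 ^ w.1.2)) q.
Let algs := smap (fun w : param => level_alg R w.1.1 w.1.2) q.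

Lemma level_sigma_algebra (i : star S nat) : i <=* nu ->
  rel1 (sigma_algebra_on (Omega R)) (app algs i).
Proof.
move: q_valid; rewrite /nu /algs; have [z [-> ->]] := spairP q i.
rewrite !smap_smap app_smap sset_smap rel1_smap => + _.
apply: sset_sub => a [n_gt0 _]; apply: grid_alg_sigma_algebra.
by rewrite muln_gt0 n_gt0 expn_gt0.
Qed.

Lemma level_alg0 : app algs (std S 0%N) = ext1 (@fms_alg R) space.
Proof.
rewrite (stdE 0%N q) app_smap ext1_smap; apply: eq_smap_in q_valid _.
(* [grid_space] is built on [N.-1.+1] cells, which is [N] by positivity. *)
move=> a [n_gt0 _] /=; rewrite /level_alg subn0 prednK //.
by rewrite muln_gt0 n_gt0 expn_gt0.
Qed.

Lemma level_decreasing (i j : star S nat) : i <=* nu -> j <=* i ->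
  forall A : star S (set R), A \in* app algs i -> A \in* app algs j.
Proof.
move=> _ + A; move: q_valid; rewrite /algs.
have [z [-> ->]] := spairP q i; have [y [-> ->]] := spairP z j.
have [x [-> ->]] := spairP y A.
rewrite !smap_smap sset_smap !app_smap !smem_smap sle_smap => qP ji Ai.
apply: sset_sub (sset_and (sset_and qP ji) Ai) => a [[[n_gt0 m_gt0] ji'] Ai'].
exact: level_alg_decreasing ji' _ Ai'.
Qed.

Definition level_filtration : reverse_filtration R nu :=
  ReverseFiltration level_sigma_algebra level_alg0 level_decreasing.

Let F : star S (R * R -> R) :=
  smap (fun w : param => evolution w.1.1 w.1.2 w.2) q.
Let Fbar : star S (R * R -> R) :=
  smap (fun w : param => lifted w.1.1 w.1.2 w.2) q.

Lemma prod_algE : prod_alg (Omega R) (Time R) (total_alg level_filtration)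
    (Dalg R nu) =
  smap (fun w : param => <<s Omega R `*` Time R,
    [set A `*` B | A in level_alg R w.1.1 w.1.2 0 &
                   B in time_alg R w.1.2] >>) q.
Proof.
by rewrite /prod_alg /total_alg -level_alg0 (stdE 0%N q) app_smap
  /Dalg ext1_smap ext2_smap.
Qed.

Lemma Fbar_extends (i j : star S nat) : i <* eta -> j <=* nu ->
  app Fbar (spair (sfrac R i eta) (sfrac R j nu)) =
  app F (spair (sfrac R i eta) (sfrac R j nu)).
Proof.
move: q_valid; rewrite /nu /eta /F /Fbar /sfrac.
have [z [-> ->]] := spairP q i; have [y [-> ->]] := spairP z j.
rewrite !smap_smap sset_smap slt_smap !ext2_smap spair_smap !app_smap.
move=> qP i_lt _.
apply: eq_smap_in (sset_and qP i_lt) _ => a [[n_gt0 m_gt0]].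
exact: lifted_grid.
Qed.

Lemma F_measurable : process_measurable level_filtration F.
Proof.
rewrite /process_measurable prod_algE; apply/smeasurable_smap.
by apply: sset_sub q_valid => w [n_gt0 m_gt0]; exact: evolution_measurable.
Qed.

Lemma Fbar_measurable : process_measurable level_filtration Fbar.
Proof.
rewrite /process_measurable prod_algE; apply/smeasurable_smap.
by apply: sset_sub q_valid => w [n_gt0 m_gt0]; exact: lifted_measurable.
Qed.

Lemma Fbar_adapted : adapted level_filtration Fbar.
Proof.
split; first exact: Fbar_measurable.
move=> i _ /=; move: q_valid; rewrite /nu /algs /Fbar /slice /sfrac.
have [z [-> ->]] := spairP q i.
rewrite !smap_smap sset_smap app_smap !ext2_smap => qP.
apply/smeasurable_smap; apply: sset_sub qP => a [n_gt0 m_gt0].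
exact: lifted_adapted.
Qed.

Lemma Fbar_cond_exp (i j : star S nat) : j <=* i -> i <=* nu ->
  is_cond_exp level_filtration i (slice Fbar (sfrac R j nu))
    (slice Fbar (sfrac R i nu)).
Proof.
rewrite /is_cond_exp /same_integrals /=; move: q_valid.
rewrite /nu /algs /space /Fbar /slice /sfrac.
have [z [-> ->]] := spairP q i; have [y [-> ->]] := spairP z j.
rewrite !smap_smap sset_smap !sle_smap !ext2_smap app_smap => qP ji im.
have {qP ji im}qP := sset_and (sset_and qP ji) im.
split.
- apply/smeasurable_smap; apply: sset_sub qP => a [[[n_gt0 m_gt0] _] _].
  exact: lifted_adapted.
- apply/same_integrals_smap; apply: sset_sub qP => a [[[n_gt0 m_gt0] ji] im] U.
  exact: lifted_same_integrals.
(* For uniqueness the competitor [g'] and then the point [w] are merged into the parameter, which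
   reduces the claim to standard functions. *)
- move=> g'; move: qP; have [x [-> ->]] := spairP y g'.
  rewrite sset_smap !smap_smap => qP /smeasurable_smap mg' /same_integrals_smap.
  move=> /(sset_and mg') /(sset_and qP) {mg' qP}qP w; move: qP.
  have [v [-> ->]] := spairP x w.
  rewrite sset_smap rel1_smap !smap_smap !app_smap => qP Ow.
  apply: eq_smap_in (sset_and qP Ow) _ => -[[[[[[n m] f] i'] j'] h] w'] /=.
  move=> [[[[[n_gt0 m_gt0] ji] im] [mg' g'E]] Oa].
  have mF := lifted_adapted f n_gt0 m_gt0 i'.
  apply: (level_integral_inj n_gt0 im mg' mF _ Oa).
  (* Both [g'] and the slice at time [i] have the integrals of the slice at time [j]. *)
  by move=> U GU; rewrite g'E //; apply/esym/lifted_same_integrals.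
Qed.

Lemma cdf_eq (x t : star S R) : rel1 (Time R) t ->
  Defs.cdf level_filtration F x t = Defs.cdf level_filtration Fbar x t.
Proof.
rewrite /Defs.cdf /=; move: q_valid; rewrite /space /F /Fbar /slice.
have [z [-> ->]] := spairP q x; have [y [-> ->]] := spairP z t.
rewrite !smap_smap sset_smap rel1_smap !ext2_smap !ext3_smap => qP Tt.
apply: eq_smap_in (sset_and qP Tt) _ => a [[n_gt0 m_gt0]].
exact: lifted_distribution.
Qed.

End Filtration.

(** Both [ln e] and the difference of logarithms are negative, so the second factor exceeds 1 and
    the lower bound is positive. This supplies the positivity of [nu]. *)
Lemma time_grid_gt0 (n m : nat) (e : R) : (1 < n)%N -> 0 < e -> e < 1 ->
  (n%:R - 1) *
    (1 + ln e / (ln (3%:R ^+ (n - 1) - 1) - ln (3%:R ^+ (n - 1)))) <= m%:R ->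
  (0 < m)%N.
Proof.
move=> n_gt1 e_gt0 e_lt1; rewrite -(ltr0n R) => /(lt_le_trans _); apply.
have k_gt0 : (0 < n - 1)%N by rewrite subn_gt0.
have p_gt1 : 1 < 3%:R ^+ (n - 1) :> R by rewrite exprn_egt1 ?ltr1n // -lt0n.
apply: mulr_gt0; first by rewrite subr_gt0 ltr1n.
rewrite addr_gt0 // nmulr_rgt0 ?ln_lt0 ?e_gt0 // invr_lt0 subr_lt0.
by rewrite ltr_ln ?posrE ?subr_gt0 ?(lt_trans ltr01) // gtrBl.
Qed.

End Process.

Theorem theorem0p10 (R : realType) (S : nsextension)
    (eta lambda nu : star S nat) (epsilon : star S R) (f : star S (R -> R))
    (eta_infinite : infinite eta) (lambda_infinite : infinite lambda)
    (epsilon_gt0 : std S 0 <* epsilon)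
    (epsilon_infinitesimal : epsilon ≃ std S 0)
    (lambda_epsilon :
      ext2 (fun l e => l%:R * e) lambda epsilon ≃ std S 0)
    (nu_ge : rel3 (fun n m e =>
        (n%:R - 1) *
          (1 + ln e / (ln (3%:R ^+ (n - 1) - 1) - ln (3%:R ^+ (n - 1))))
        <= m%:R) eta nu epsilon)
    (f_ge0 : forall x : star S R, rel1 (Omega R) x -> std S 0 <=* app f x)
    (f_measurable : smeasurable (Omega R) (Calg R eta) f)
    (f_sum :
      ext2 (fun n f => \sum_(i < n) f (i%:R / n%:R)) eta f = snatr R lambda) :
  exists (E : reverse_filtration R nu) (Fbar : star S (R * R -> R)),
    [/\ forall i j : star S nat, i <* eta -> j <=* nu ->
          app Fbar (spair (sfrac R i eta) (sfrac R j nu)) =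
          app (process eta nu f) (spair (sfrac R i eta) (sfrac R j nu)),
        reverse_martingale E Fbar &
        equivalent_in_distribution E (process eta nu f) Fbar].
Proof.
move=> {lambda_infinite lambda_epsilon f_ge0 f_measurable f_sum}.
have eta_gt1 : sset (fun n => (1 < n)%N) eta.
  have neq k : sset (fun n => n <> k) eta.
    rewrite (ssetC S (fun n => n = k) : sset (fun n => n <> k) = _) => eta_k.
    apply: (eta_infinite k); rewrite (stdE k eta) -[LHS]smap_id.
    exact/smap_eqP.
  by apply: sset_sub (sset_and (neq 0%N) (neq 1%N)) => -[|[|n]] [].
(* Index 0 gives the bound 1 on [epsilon], which makes its logarithm negative. *)
have := epsilon_infinitesimal 0%N.
move: eta_gt1 nu_ge epsilon_gt0 {eta_infinite epsilon_infinitesimal}.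
have [p [-> ->]] := spairP eta nu; have [q [-> ->]] := spairP p f.
have [r [-> ->]] := spairP q epsilon.
rewrite !smap_smap sset_smap rel3_smap (stdE _ r) slt_smap rel2_smap.
move=> n_gt1 nu_ge e_gt0 e_lt1.
have rP : sset (fun w : nat * nat * (R -> R) => (0 < w.1.1)%N /\ (0 < w.1.2)%N)
    (smap fst r).
  rewrite sset_smap.
  apply: sset_sub (sset_and (sset_and n_gt1 nu_ge) (sset_and e_gt0 e_lt1)) => a.
  move=> [[n_gt1' nu_ge'] [e_gt0' e_lt1']]; split; first exact: ltnW.
  apply: time_grid_gt0 nu_ge' => //.
  by rewrite subr0 invr1 gtr0_norm // in e_lt1'.
(* The construction depends on [r] only through the triple [(n, m, f)], so everything is rewritten
   as an image of [z]. *)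
set z := smap fst r in rP *.
have eqs (T : Type) (g : nat * nat * (R -> R) -> T) :
    smap (fun w => g w.1) r = smap g z by rewrite /z smap_smap.
rewrite (eqs _ (fun w => w.1.1)) (eqs _ (fun w => w.1.2)).
rewrite (eqs _ (fun w => w.2)).
have -> : process (smap (fun w => w.1.1) z) (smap (fun w => w.1.2) z)
    (smap (fun w => w.2) z) = smap (fun w => evolution w.1.1 w.1.2 w.2) z.
  exact: ext3_smap.
exists (level_filtration rP), (smap (fun w => lifted w.1.1 w.1.2 w.2) z).
split.
- exact: Fbar_extends.
- split; [exact: Fbar_adapted | exact: Fbar_cond_exp].
- split; [exact: F_measurable | exact: Fbar_measurable | exact: cdf_eq].
Qed.
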